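(* There are no compact $H$-tensional submanifolds (of dimension $m\ge1$) of the Euclidean space $\mathbb{R}^n$.
   Context: Manifolds are smooth and without boundary. A Riemannian submanifold $\iota:(M^m,g)\to(N^n,h)$ is a (connected) manifold $M$ together with an isometric immersion $\iota$; here $(N,h)$ is $\mathbb{R}^n$ with its canonical Euclidean metric. The tension field is $\tau(\iota)=\sum_{i=1}^m\{\nabla^\iota_{e_i}d\iota(e_i)-d\iota(\nabla_{e_i}e_i)\}$ ($\{e_i\}$ a local orthonormal frame of $(M,g)$, $\nabla$ the Levi-Civita connection of $(M,g)$, $\nabla^\iota$ the connection on $\iota^{-1}TN$ induced by the Levi-Civita connection of $(N,h)$). The rough Laplacian on sections $\xi$ of $\iota^{-1}TN$ is $\Delta^\iota\xi=-\sum_{i=1}^m(\nabla^\iota_{e_i}\nabla^\iota_{e_i}\xi-\nabla^\iota_{\nabla_{e_i}e_i}\xi)$. $M$ is called $H$-tensional if $\Delta^\iota\tau(\iota)=0$. *)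

(* Defs.v *)
From HB Require Import structures.
From mathcomp Require Import all_boot all_order all_algebra.
From mathcomp Require Import all_classical all_reals all_analysis.
From mathcomp Require Import ring.
Import Order.TTheory GRing.Theory Num.Theory.
Import numFieldNormedType.Exports.

Set Implicit Arguments.
Unset Strict Implicit.
Unset Printing Implicit Defensive.

Local Open Scope classical_set_scope.
Local Open Scope ring_scope.

(* Points and tangent vectors of R^m are row vectors, so the Jacobian acts on
   the right: 'd f x u = u *m jacobian f x. *)

Section Smooth.
Context {R : realType} {V W : normedModType R}.

(* Class C^k on U, which is meant to be open. *)
Fixpoint Ck_on (k : nat) (U : set V) (f : V -> W) : Prop :=
  if k is k'.+1 then
    (forall x, U x -> differentiable f x) /\
    (forall v, Ck_on k' U (fun x => 'D_v f x))
  else forall x, U x -> {for x, continuous f}.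

Definition smooth_on (U : set V) (f : V -> W) : Prop :=
  forall k, Ck_on k U f.

End Smooth.

(* A smooth structure without boundary on M, given by a smooth atlas.
   [coord a] and [param a] are inverse homeomorphisms between the open sets
   [cdom a] of M and [coord a @` cdom a] of R^m; their values outside of these
   sets are junk. *)
Record smooth_manifold (R : realType) (m : nat) (M : topologicalType) :=
  SmoothManifold {
    atlas : Type ;
    cdom : atlas -> set M ;
    coord : atlas -> M -> 'rV[R]_m ;
    param : atlas -> 'rV[R]_m -> M ;
    manifold_hausdorff : hausdorff_space M ;
    manifold_second_countable : @second_countable M ;
    cdom_open : forall a, open (cdom a) ;
    cimage_open : forall a, open (coord a @` cdom a) ;
    coordK : forall a p, cdom a p -> param a (coord a p) = p ;
    coord_continuous : forall a, {within cdom a, continuous (coord a)} ;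
    param_continuous :
      forall a, {within coord a @` cdom a, continuous (param a)} ;
    cdom_cover : forall p, exists a, cdom a p ;
    transition_smooth : forall a b,
      smooth_on (coord a @` (cdom a `&` cdom b)) (coord b \o param a)
  }.

Definition cimage (R : realType) (m : nat) (M : topologicalType)
    (A : smooth_manifold R m M) (a : atlas A) : set 'rV[R]_m :=
  coord a @` cdom a.

Definition dotG (R : realType) (m : nat) (G : 'M[R]_m) (u v : 'rV[R]_m) : R :=
  (u *m G *m v^T) 0 0.

Definition dotE (R : realType) (n : nat) (u v : 'rV[R]_n) : R :=
  (u *m v^T) 0 0.

(* [gmx a x] is the Gram matrix of the coordinate vector fields of the chart a
   at the point with coordinates x; [gmx_compat] is the transformation law of
   a covariant 2-tensor. *)
Record riemannian_metric (R : realType) (m : nat) (M : topologicalType)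
    (A : smooth_manifold R m M) := RiemannianMetric {
  gmx : atlas A -> 'rV[R]_m -> 'M[R]_m ;
  gmx_smooth : forall a, smooth_on (cimage a) (gmx a) ;
  gmx_sym : forall a x, cimage a x -> (gmx a x)^T = gmx a x ;
  gmx_pos : forall a x, cimage a x ->
    forall u, u != 0 -> 0 < dotG (gmx a x) u u ;
  gmx_compat : forall a b x, (coord a @` (cdom a `&` cdom b)) x ->
    let T := coord b \o param a in
    gmx a x = jacobian T x *m gmx b (T x) *m (jacobian T x)^T
}.

Definition isometric_immersion (R : realType) (m n : nat)
    (M : topologicalType) (A : smooth_manifold R m M)
    (g : riemannian_metric A) (iota : M -> 'rV[R]_n) : Prop :=
  forall a : atlas A,
    [/\ smooth_on (cimage a) (iota \o param a),
        forall x, cimage a x -> injective ('d (iota \o param a) x) &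
        forall x, cimage a x -> forall u v,
          dotE ('d (iota \o param a) x u) ('d (iota \o param a) x v) =
          dotG (gmx g a x) u v].

(* In the following section everything is written in one coordinate patch of
   M: G is the matrix of the metric, a vector field is its row of components,
   F is the coordinate expression of iota, and a section of iota^{-1} TR^n is
   a function with values in R^n. *)
Section CoordinatePatch.
Context {R : realType} {m n : nat}.
Implicit Types (G : 'rV[R]_m -> 'M[R]_m) (X Y : 'rV[R]_m -> 'rV[R]_m).
Implicit Types (F xi : 'rV[R]_m -> 'rV[R]_n) (x : 'rV[R]_m).
Implicit Types (E : 'I_m -> 'rV[R]_m -> 'rV[R]_m).

(* The derivative at x of the (i, j) entry of G in the k-th coordinate. *)
Definition dmetric G x (k i j : 'I_m) : R :=
  'D_(delta_mx 0 k : 'rV[R]_m) (fun y => G y i j) x.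

(* The Christoffel symbol Gamma^k_{ij}. *)
Definition christoffel G x (k i j : 'I_m) : R :=
  2^-1 * \sum_(l < m) invmx (G x) k l *
    (dmetric G x i j l + dmetric G x j i l - dmetric G x l i j).

(* The Levi-Civita connection: nabla_X Y at x. *)
Definition levi_civita G X Y x : 'rV[R]_m :=
  'D_(X x) Y x +
  \row_(k < m) \sum_(i < m) \sum_(j < m)
     christoffel G x k i j * X x 0 i * Y x 0 j.

(* The Levi-Civita connection of Euclidean space is componentwise
   differentiation, hence so is the connection it induces along F. *)
Definition nabla_along X xi x : 'rV[R]_n := 'D_(X x) xi x.

Definition pushforward F X x : 'rV[R]_n := 'd F x (X x).

Definition orthonormal_frame G (V : set 'rV[R]_m) E : Prop :=
  (forall i, smooth_on V (E i)) /\
  (forall x, V x -> forall i j, dotG (G x) (E i x) (E j x) = (i == j)%:R).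

Definition tension_field G E F x : 'rV[R]_n :=
  \sum_(i < m) (nabla_along (E i) (pushforward F (E i)) x
                - pushforward F (levi_civita G (E i) (E i)) x).

Definition rough_laplacian G E xi x : 'rV[R]_n :=
  - \sum_(i < m) (nabla_along (E i) (nabla_along (E i) xi) x
                  - nabla_along (levi_civita G (E i) (E i)) xi x).

(* [christoffel] defines the torsion-free metric connection. *)

Lemma dmetric_sym G x k i j :
  (\forall y \near x, (G y)^T = G y) -> dmetric G x k i j = dmetric G x k j i.
Proof.
move=> symG; rewrite /dmetric; apply: near_eq_derive.
by near=> y; rewrite -[in LHS](near symG y) ?mxE.
Unshelve. all: by end_near. Qed.

Lemma christoffel_torsion_free G x k i j :
  (\forall y \near x, (G y)^T = G y) ->
  christoffel G x k i j = christoffel G x k j i.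
Proof.
move=> symG; rewrite /christoffel; congr (_ * _); apply: eq_bigr => l _.
by rewrite (dmetric_sym l i j symG) (addrC (dmetric G x i j l)).
Qed.

Lemma christoffel_metric G x k i j :
  (\forall y \near x, (G y)^T = G y) -> G x \in unitmx ->
  dmetric G x k i j =
  \sum_(l < m) (christoffel G x l k i * G x l j +
                christoffel G x l k j * G x i l).
Proof.
move=> symG Gu; have Gs p q : G x p q = G x q p.
  by rewrite -[in LHS](nbhs_singleton symG) mxE.
have invG r q : \sum_(l < m) invmx (G x) l r * G x l q = (q == r)%:R.
  have /matrixP /(_ q r) := mulmxV Gu; rewrite !mxE => <-.
  by apply: eq_bigr => l _; rewrite mulrC Gs.
have lower p q : \sum_(l < m) christoffel G x l k p * G x l q =
    2^-1 * (dmetric G x k p q + dmetric G x p k q - dmetric G x q k p).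
  under eq_bigr => l _ do rewrite /christoffel -mulrA mulr_suml.
  rewrite -mulr_sumr exchange_big /=; congr (_ * _).
  under eq_bigr => r _.
    under eq_bigr => l _ do rewrite mulrAC.
    rewrite -mulr_suml invG.
    over.
  rewrite (bigD1 q) //= eqxx mul1r big1 ?addr0 // => r rq.
  by rewrite eq_sym (negbTE rq) mul0r.
rewrite big_split /= lower.
under eq_bigr => l _ do rewrite (Gs i l).
rewrite lower (dmetric_sym k j i symG) (dmetric_sym i k j symG).
rewrite (dmetric_sym j k i symG) (dmetric_sym i j k symG).
by field.
Qed.

End CoordinatePatch.

(* The tension field and the rough Laplacian are both computed in a smooth
   orthonormal frame E over an open subset V of a coordinate patch, for every
   such patch, V and E. *)
Definition H_tensional (R : realType) (m n : nat) (M : topologicalType)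
    (A : smooth_manifold R m M) (g : riemannian_metric A)
    (iota : M -> 'rV[R]_n) : Prop :=
  forall (a : atlas A) (V : set 'rV[R]_m) (E : 'I_m -> 'rV[R]_m -> 'rV[R]_m),
    open V -> V `<=` cimage a -> orthonormal_frame (gmx g a) V E ->
    forall x, V x ->
      rough_laplacian (gmx g a) E
        (tension_field (gmx g a) E (iota \o param a)) x = 0.

(* Main.v *)
Require Import Defs.
From mathcomp Require Import all_boot all_order all_algebra.
From mathcomp Require Import all_classical all_reals all_analysis.
From mathcomp Require Import ring lra.
Import Order.TTheory GRing.Theory Num.Theory.
Import numFieldNormedType.Exports.
Local Open Scope classical_set_scope.
Local Open Scope ring_scope.

(** The rough Laplacian of an R^n-valued map is the Laplace-Beltrami operator on
    each component, so an H-tensional submanifold is one whose tension field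
    tau has harmonic components. The usual argument integrates over M; here two
    applications of the second derivative test at a maximum suffice, because
    tau is a normal field.

    For any smooth map f into R^n, half of the Laplacian of |f|^2 is
    <Lap f, f> + sum_i |D_(e_i) f|^2, and it is nonpositive where |f|^2 is
    maximal ([laplacian_at_local_max]; [rough_laplacian] is - Lap).

    Take f = tau. As Lap tau = 0, all D_(e_i) tau vanish at a maximum p of
    |tau|^2. By the Gauss formula <tau, d iota(e_i)> = 0 identically
    ([tension_field_normal]); differentiating this along e_i and summing over i
    gives <tau, sum_i D_(e_i) (d iota(e_i))> = 0 at p. The sum on the right
    differs from tau by a tangent vector, so |tau(p)|^2 = 0
    ([tension_eq0_at_max]), and tau vanishes on all of M.

    Take f = iota. Now Lap iota = tau = 0, whereas
    sum_i |d iota(e_i)|^2 = m > 0, which contradicts the inequality above at a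
    maximum of |iota|^2 ([tension_neq0_at_max]).

    Three facts make this meaningful on a manifold. Every chart carries a smooth
    orthonormal frame, by Gram-Schmidt ([orthonormal_frame_exists]), so that the
    hypothesis on the rough Laplacian has content. The vector tau does not
    depend on the chart and the frame ([tension_field_reparam]), so that |tau|^2
    is a continuous function on M. And compactness of M yields the maxima, each
    of which is a maximum in the coordinates of a chart
    ([compact_max_in_chart]). *)

Set Implicit Arguments.
Unset Strict Implicit.
Unset Printing Implicit Defensive.

(** * Calculus of smooth maps *)

Section CkCalculus.
Context {R : realType} {V : normedModType R}.
Implicit Types (U : set V) (k : nat).

(** A map that agrees with f near x has the same first-order expansion at x, so
    the differential of f serves for it. *)
Lemma near_eq_differentiable (W : normedModType R) (f g : V -> W) x :
  (\near x, f x = g x) -> differentiable f x -> differentiable g x.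
Proof.
move=> fg df; have cdf : continuous ('d f x) by exact: diff_continuous.
have gE : g \o shift x = cst (g x) + 'd f x +o_ 0 id.
  apply/eqaddoP => e e0; rewrite -(nbhs_singleton fg).
  have /eqaddoP/(_ _ e0) := diff_locally df; apply: filter_app.
  have : \forall h \near 0, f (h + x) = g (h + x).
    by move: fg; rewrite (near_shift 0) /= subr0.
  apply: filter_app; near=> h => efg.
  rewrite -[(f \o shift x - _) h]/(f (h + x) - (f x + 'd f x h)).
  by rewrite -[(g \o shift x - _) h]/(g (h + x) - (f x + 'd f x h)) efg.
have dg := diff_unique cdf gE.
by apply/diff_locallyP; rewrite dg.
Unshelve. all: by end_near. Qed.

Lemma open_near_eq (W : Type) U (f g : V -> W) x :
  open U -> (forall y, U y -> f y = g y) -> U x -> \near x, f x = g x.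
Proof.
move=> oU fg Ux; near=> y; apply: fg; near: y; exact: open_nbhs_nbhs.
Unshelve. all: by end_near. Qed.

Lemma Ck_on_eq (W : normedModType R) k U (f g : V -> W) : open U ->
  (forall x, U x -> f x = g x) -> Ck_on k U f -> Ck_on k U g.
Proof.
move=> oU; elim: k f g => [|k IH] f g fg /=.
  move=> cf x Ux; have := cf x Ux; rewrite /prop_for /continuous_at -fg//.
  move=> h; apply: cvg_trans h; apply: near_eq_cvg.
  by apply: open_near_eq Ux => // y Uy; rewrite fg.
move=> [df Df]; split=> [x Ux|v].
  by apply: near_eq_differentiable (df x Ux); exact: open_near_eq Ux.
apply: IH (Df v) => x Ux; apply: near_eq_derive; exact: open_near_eq Ux.
Qed.

Lemma Ck_on_pred (W : normedModType R) k U (f : V -> W) :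
  Ck_on k.+1 U f -> Ck_on k U f.
Proof.
elim: k f => [|k IH] f [df Df].
  by move=> x Ux; exact/differentiable_continuous/df.
by split=> // v; apply: IH.
Qed.

Lemma Ck_on_cst (W : normedModType R) k U (c : W) : Ck_on k U (fun=> c).
Proof.
elim: k c => [|k IH] c /=; first by move=> x _; exact: cvg_cst.
split=> [x _|v]; first exact: differentiable_cst.
by under eq_fun do rewrite derive_cst.
Qed.

Lemma Ck_onD (W : normedModType R) k U (f g : V -> W) : open U ->
  Ck_on k U f -> Ck_on k U g -> Ck_on k U (fun x => f x + g x).
Proof.
move=> oU; elim: k f g => [|k IH] f g /=.
  by move=> cf cg x Ux; apply: cvgD; [exact: cf|exact: cg].
move=> [df Df] [dg Dg]; split=> [x Ux|v].
  by apply: differentiableD; [exact: df|exact: dg].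
apply: Ck_on_eq (IH _ _ (Df v) (Dg v)) => // x Ux.
by rewrite deriveD //; apply: diff_derivable; [exact: df|exact: dg].
Qed.

Lemma Ck_onM k U (f g : V -> R) : open U ->
  Ck_on k U f -> Ck_on k U g -> Ck_on k U (fun x => f x * g x).
Proof.
move=> oU; elim: k f g => [|k IH] f g.
  by move=> cf cg x Ux; apply: cvgM; [exact: cf|exact: cg].
move=> Cf Cg; have [df Df] := Cf; have [dg Dg] := Cg.
split=> [x Ux|v].
  by apply: differentiableM; [exact: df|exact: dg].
have := Ck_onD oU (IH _ _ (Ck_on_pred Cf) (Dg v))
  (IH _ _ (Ck_on_pred Cg) (Df v)).
apply: Ck_on_eq => // x Ux.
by rewrite deriveM //; apply: diff_derivable; [exact: df|exact: dg].
Qed.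

Lemma differentiable_mxP p q (f : V -> 'M[R]_(p, q)) x :
  differentiable f x <-> forall i j, differentiable (fun y => f y i j) x.
Proof.
split=> [df i j|df].
  exact: (differentiable_comp df (differentiable_coord _ i j)).
have -> : f = \sum_(i < p) (\sum_(j < q) (fun y => f y i j *: delta_mx i j)).
  apply/funext => y; rewrite fct_sumE {1}[f y]matrix_sum_delta.
  by apply: eq_bigr => i _; rewrite fct_sumE.
by do 2! apply: differentiable_sum => ?; exact: differentiableZl.
Qed.

Lemma derive_entry p q (f : V -> 'M[R]_(p, q)) x v i j :
  derivable f x v -> ('D_v f x) i j = 'D_v (fun y => f y i j) x.
Proof. by move=> df; rewrite derive_mx // mxE. Qed.

Lemma continuous_mxP p q (f : V -> 'M[R]_(p, q)) x :
  {for x, continuous f} <-> forall i j, {for x, continuous (fun y => f y i j)}.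
Proof.
split=> [cf i j|cf].
  apply: (@continuous_comp _ _ _ f (fun N : 'M[R]_(p, q) => N i j : R)) => //.
  exact: coord_continuous.
apply/cvgrPdist_le => e e0; near=> y.
rewrite /Num.Def.normr /= mx_normrE (bigmax_le _ (ltW e0)) //= => i _.
rewrite !mxE /=; move: i; near: y; apply: filter_forall => -[i j] /=.
exact: ((cvgrPdist_le _ _).1 (cf i j)).
Unshelve. all: by end_near. Qed.

(** This reduces the smoothness of vector- and matrix-valued maps to that of
    scalar functions, where products are available. *)
Lemma Ck_on_mxP p q k U (f : V -> 'M[R]_(p, q)) : open U ->
  Ck_on k U f <-> forall i j, Ck_on k U (fun x => f x i j).
Proof.
move=> oU; elim: k f => [|k IH] f.
  split=> [cf i j x Ux|cf x Ux]; first by have /continuous_mxP := cf x Ux.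
  by apply/continuous_mxP => i j; exact: cf.
split=> [[df Df] i j|Cf].
  split=> [x Ux|v]; first by have /differentiable_mxP := df x Ux.
  have /IH/(_ i j) := Df v; apply: Ck_on_eq => // x Ux.
  by rewrite derive_entry //; exact/diff_derivable/df.
have df x : U x -> differentiable f x.
  by move=> Ux; apply/differentiable_mxP => i j; case: (Cf i j) => + _; apply.
split=> // v; apply/IH => i j; have [_ /(_ v)] := Cf i j.
apply: Ck_on_eq => // x Ux.
by rewrite derive_entry //; exact/diff_derivable/df.
Qed.

Lemma smooth_on_differentiable (W : normedModType R) U (f : V -> W) x :
  smooth_on U f -> U x -> differentiable f x.
Proof. by move=> /(_ 1%N)[df _] /df. Qed.

Lemma smooth_on_derivable (W : normedModType R) U (f : V -> W) x v :
  smooth_on U f -> U x -> derivable f x v.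
Proof. by move=> sf Ux; exact/diff_derivable/(smooth_on_differentiable sf). Qed.

Lemma smooth_on_derive (W : normedModType R) U (f : V -> W) v :
  smooth_on U f -> smooth_on U (fun x => 'D_v f x).
Proof. by move=> sf k; have [_] := sf k.+1; apply. Qed.

Lemma smooth_on_eq (W : normedModType R) U (f g : V -> W) : open U ->
  (forall x, U x -> f x = g x) -> smooth_on U f -> smooth_on U g.
Proof. by move=> oU fg sf k; exact: Ck_on_eq (sf k). Qed.

Lemma smooth_on_cst (W : normedModType R) U (c : W) : smooth_on U (fun=> c).
Proof. by move=> k; exact: Ck_on_cst. Qed.

Lemma smooth_onD (W : normedModType R) U (f g : V -> W) : open U ->
  smooth_on U f -> smooth_on U g -> smooth_on U (fun x => f x + g x).
Proof. by move=> oU sf sg k; exact: Ck_onD. Qed.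

Lemma smooth_onM U (f g : V -> R) : open U ->
  smooth_on U f -> smooth_on U g -> smooth_on U (fun x => f x * g x).
Proof. by move=> oU sf sg k; exact: Ck_onM. Qed.

Lemma smooth_on_sum (W : normedModType R) (I : Type) (r : seq I) (P : pred I)
    U (f : I -> V -> W) : open U ->
  (forall i, P i -> smooth_on U (f i)) ->
  smooth_on U (fun x => \sum_(i <- r | P i) f i x).
Proof.
move=> oU sf; elim: r => [|i r IH].
  by under eq_fun do rewrite big_nil; exact: smooth_on_cst.
under eq_fun do rewrite big_cons.
by case: (boolP (P i)) => // Pi; apply: smooth_onD => //; exact: sf.
Qed.

Lemma smooth_on_mxP p q U (f : V -> 'M[R]_(p, q)) : open U ->
  smooth_on U f <-> forall i j, smooth_on U (fun x => f x i j).
Proof.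
move=> oU; split=> [sf i j k|sf k]; first by move/Ck_on_mxP: (sf k); apply.
by apply/Ck_on_mxP => // i j; exact: sf.
Qed.

Lemma smooth_onZ n U (c : V -> R) (f : V -> 'rV[R]_n) : open U ->
  smooth_on U c -> smooth_on U f -> smooth_on U (fun x => c x *: f x).
Proof.
move=> oU sc /smooth_on_mxP-/(_ oU) sf; apply/smooth_on_mxP => // i j.
by under eq_fun do rewrite mxE; exact: smooth_onM.
Qed.

Lemma smooth_onB n U (f g : V -> 'rV[R]_n) : open U ->
  smooth_on U f -> smooth_on U g -> smooth_on U (fun x => f x - g x).
Proof.
move=> oU sf sg; under eq_fun do rewrite -scaleN1r.
apply: smooth_onD => //; apply: smooth_onZ => //; exact: smooth_on_cst.
Qed.

Lemma dotEE n (u v : 'rV[R]_n) : dotE u v = \sum_i u 0 i * v 0 i.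
Proof. by rewrite /dotE mxE; apply: eq_bigr => i _; rewrite mxE. Qed.

Lemma smooth_on_dotE n U (f g : V -> 'rV[R]_n) : open U ->
  smooth_on U f -> smooth_on U g -> smooth_on U (fun x => dotE (f x) (g x)).
Proof.
move=> oU /smooth_on_mxP-/(_ oU) sf /smooth_on_mxP-/(_ oU) sg.
under eq_fun do rewrite dotEE.
by apply: smooth_on_sum => // i _; exact: smooth_onM.
Qed.

(** With s = 1 / sqrt f one has D_v s = - (D_v f) s^3 / 2, which is C^k as
    soon as f is C^(k+1) and s is C^k; this allows the induction on k. It is
    the normalization factor of Gram-Schmidt. *)
Lemma smooth_on_invsqrt U (f : V -> R) : open U ->
  (forall x, U x -> 0 < f x) -> smooth_on U f ->
  smooth_on U (fun x => (Num.sqrt (f x))^-1).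
Proof.
move=> oU f0 sf.
have dsq (r : R) : 0 < r -> is_derive r 1 (fun t : R => (Num.sqrt t)^-1)
    (- (2^-1 * (Num.sqrt r)^-1 ^+ 3)).
  move=> r0; have sr0 : Num.sqrt r != 0 by rewrite gt_eqF // sqrtr_gt0.
  have := is_derive1_sqrt r0 => -[dr dE].
  apply: DeriveDef; first exact: derivableV.
  rewrite deriveV // dE -[_ *: _]/(_ * _).
  by field.
have Ds x : U x -> differentiable (fun y => (Num.sqrt (f y))^-1) x.
  move=> Ux.
  apply: (@differentiable_comp _ _ _ _ f (fun t : R => (Num.sqrt t)^-1)).
    exact: smooth_on_differentiable sf Ux.
  by apply/derivable1_diffP; case: (dsq _ (f0 _ Ux)).
elim=> [|k IH]; first by move=> x Ux; exact/differentiable_continuous/Ds.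
split=> // v.
have C : Ck_on k U (fun x => - 2^-1 * 'D_v f x *
   ((Num.sqrt (f x))^-1 * ((Num.sqrt (f x))^-1 * (Num.sqrt (f x))^-1))).
  have [_ Df] := sf k.+1.
  apply: (Ck_onM oU); last exact: (Ck_onM oU IH (Ck_onM oU IH IH)).
  by apply: (Ck_onM oU) (Df v); exact: Ck_on_cst.
apply: Ck_on_eq C => // x Ux.
rewrite [RHS]deriveE; last exact: Ds.
have df := smooth_on_differentiable sf Ux.
have dg : differentiable (fun t : R => (Num.sqrt t)^-1) (f x).
  by apply/derivable1_diffP; case: (dsq _ (f0 _ Ux)).
have := @diff_comp _ _ _ _ f (fun t : R => (Num.sqrt t)^-1) x df dg.
rewrite /comp => -> /=; rewrite -(deriveE v df).
have := dsq _ (f0 _ Ux) => -[dr dE].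
rewrite -[X in _ = _ X]mulr1 -[X in _ = _ X]/('D_v f x *: 1) linearZ.
rewrite -deriveE // dE [RHS]/= -[RHS]/(_ * _).
by rewrite !exprS expr0; ring.
Qed.

End CkCalculus.

(** * Symmetry of second derivatives and the second derivative test *)

Section SecondOrder.
Context {R : realType} {V : normedModType R}.
Implicit Types (U : set V) (f : V -> R).

Lemma is_derive_line (f : V -> R) (x v : V) (t : R) :
  differentiable f (x + t *: v) ->
  is_derive t 1 (fun s : R => f (x + s *: v)) ('D_v f (x + t *: v)).
Proof.
move=> df; have dl : is_diff t (fun s : R => x + s *: v) (fun s => s *: v).
  by apply: is_diff_eq; rewrite add0r.
have dl1 : differentiable (fun s : R => x + s *: v) t by case: dl.
have dfl : differentiable (fun s : R => f (x + s *: v)) t.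
  exact: (differentiable_comp dl1 df).
apply: DeriveDef; first exact: diff_derivable.
rewrite deriveE // (diff_comp dl1 df) /= deriveE //.
by case: dl => _ ->; rewrite scale1r.
Qed.

Lemma MVT_line f (x v : V) (t : R) : 0 < t ->
  (forall s, 0 <= s <= t -> differentiable f (x + s *: v)) ->
  exists2 s, 0 < s < t & f (x + t *: v) - f x = 'D_v f (x + s *: v) * t.
Proof.
move=> t0 df; have H (s : R) : s \in `[0, t] ->
    is_derive s 1 (fun s : R => f (x + s *: v)) ('D_v f (x + s *: v)).
  by rewrite in_itv => /df; exact: is_derive_line.
have Ho (s : R) : s \in `]0, t[ ->
    is_derive s 1 (fun s : R => f (x + s *: v)) ('D_v f (x + s *: v)).
  by rewrite in_itv => /andP[s0 st]; apply: H; rewrite in_itv /= !ltW.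
have cf : {within `[0, t], continuous (fun s : R => f (x + s *: v))}.
  by apply: derivable_within_continuous => s /H[].
have [s] := MVT t0 Ho cf.
by rewrite in_itv subr0 scale0r addr0 => ? ?; exists s.
Qed.

Lemma near_parallelogram (P : V -> Prop) (x u v : V) : (\near x, P x) ->
  exists2 d : R, 0 < d & forall s r : R, `|s| <= d -> `|r| <= d ->
    P (x + s *: u + r *: v).
Proof.
move=> /nbhs_ballP[e /= e0 He]; have k0 : 0 < 1 + `|u| + `|v|.
  by rewrite -addrA ltr_pwDl // addr_ge0.
exists (e / (1 + `|u| + `|v|)) => [|s r sd rd]; first exact: divr_gt0.
apply: He; rewrite -ball_normE /= -addrA opprD addrA subrr add0r normrN.
apply: (le_lt_trans (ler_normD _ _)); rewrite !normrZ.
apply: (@le_lt_trans _ _ (e / (1 + `|u| + `|v|) * (`|u| + `|v|))).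
  by rewrite mulrDr lerD // ler_wpM2r.
by rewrite -mulrA gtr_pMr // mulrC ltr_pdivrMr // mul1r -addrA ltrDr.
Qed.

Lemma near_segment (P : V -> Prop) (x v : V) : (\near x, P x) ->
  exists2 d : R, 0 < d & forall s : R, `|s| <= d -> P (x + s *: v).
Proof.
move=> /(near_parallelogram v 0)[d d0 Hd]; exists d => // s sd.
by have := Hd s 0 sd; rewrite scaler0 addr0; apply; rewrite normr0 ltW.
Qed.

(** Two applications of the mean value theorem: first to the increment of f in
    the direction v, as a function along u, and then to D_u f along v. *)
Lemma second_difference f (x u v : V) (t : R) : 0 < t ->
  (forall s r, 0 <= s <= t -> 0 <= r <= t ->
     differentiable f (x + s *: u + r *: v) /\
     differentiable ('D_u f) (x + s *: u + r *: v)) ->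
  exists s r, [/\ 0 < s < t, 0 < r < t &
    f (x + t *: u + t *: v) - f (x + t *: v) - (f (x + t *: u) - f x) =
    'D_v ('D_u f) (x + s *: u + r *: v) * t * t].
Proof.
move=> t0 df; have t1 : 0 <= t <= t by rewrite lexx ltW.
have t2 : 0 <= (0 : R) <= t by rewrite lexx ltW.
(* The increment of f in the direction v. *)
pose g y := f (y + t *: v) - f y.
have dsh y : differentiable f (y + t *: v) ->
    is_diff y (fun y => f (y + t *: v)) ('d f (y + t *: v)).
  move=> dfy; have ds : is_diff y (fun z => z + t *: v) id.
    by apply: is_diff_eq; rewrite addr0.
  have ds1 : differentiable (fun z => z + t *: v) y by case: ds.
  apply: DiffDef; first exact: (differentiable_comp ds1 dfy).
  by rewrite (diff_comp ds1 dfy); case: ds => _ ->.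
have Dg s : 0 <= s <= t -> differentiable g (x + s *: u) /\
    'D_u g (x + s *: u) =
    'D_u f (x + s *: u + t *: v) - 'D_u f (x + s *: u).
  move=> st; have [d1 _] := df s t st t1; have [d2 _] := df s 0 st t2.
  rewrite scale0r addr0 in d2; have := dsh _ d1 => -[d3 dE].
  split; first exact: differentiableB.
  by rewrite deriveB ?(deriveE _ d3) ?dE ?deriveE //; exact: diff_derivable.
have [s /andP[s0 st] gE] : exists2 s, 0 < s < t &
    g (x + t *: u) - g x = 'D_u g (x + s *: u) * t.
  by apply: (@MVT_line g) => // s /Dg[].
have sI : 0 <= s <= t by rewrite !ltW.
have [r /andP[r0 rt] hE] : exists2 r, 0 < r < t &
    'D_u f (x + s *: u + t *: v) - 'D_u f (x + s *: u) =
    'D_v ('D_u f) (x + s *: u + r *: v) * t.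
  by apply: (@MVT_line ('D_u f)) => // r rI; case: (df s r sI rI).
have swap (a b c h : R) : a - b - (c - h) = a - c - (b - h) by ring.
exists s, r; split; [by rewrite s0|by rewrite r0|].
rewrite -hE -(proj2 (Dg _ sI)) -gE /g; exact: swap.
Qed.

(** The second difference of f is symmetric in u and v. Divided by t^2 it is a
    value of D_v D_u f, and also one of D_u D_v f, at points close to x. *)
Lemma derive_comm U f (x u v : V) : open U -> smooth_on U f -> U x ->
  'D_u ('D_v f) x = 'D_v ('D_u f) x.
Proof.
move=> oU sf Ux; apply/eqP; rewrite -subr_eq0 -normr_le0.
apply/ler_addgt0Pr => e e0; rewrite add0r.
have close (a b c : R) :
    `|a - c| <= e / 2 -> `|b - c| <= e / 2 -> `|a - b| <= e.
  move=> ac bc; rewrite (splitr e) -(subrKA c) (le_trans (ler_normD _ _)) //.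
  by rewrite lerD // distrC.
have e2 : 0 < e / 2 by rewrite divr_gt0.
have nU : \near x, U x by exact: open_nbhs_nbhs.
have C (a b : V) : {for x, continuous ('D_a ('D_b f))}.
  have sD : smooth_on U ('D_a ('D_b f)) by do 2 ! apply: smooth_on_derive.
  exact/differentiable_continuous/(smooth_on_differentiable sD).
have nC (a b : V) : \forall y \near x,
    `|'D_a ('D_b f) x - 'D_a ('D_b f) y| <= e / 2.
  by move/cvgrPdist_le: (C a b); apply.
have [d d0 Hd] := near_parallelogram u v
  (filterI nU (filterI (nC u v) (nC v u))).
have ok s : 0 <= s <= d -> `|s| <= d by case/andP=> s0; rewrite ger0_norm.
have okt s : 0 < s < d -> `|s| <= d.
  by case/andP=> s0 sd; apply: ok; rewrite !ltW.
have diffs (a b : V) y : U y -> differentiable f y /\ differentiable ('D_a f) y.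
  by move=> Uy; split; apply: smooth_on_differentiable Uy => //;
    exact: smooth_on_derive.
have [|s1 [r1 [s1d r1d E1]]] := @second_difference f x u v d d0.
  move=> s r sd rd; apply: diffs => //.
  by have [] := Hd _ _ (ok _ sd) (ok _ rd).
have [|s2 [r2 [s2d r2d E2]]] := @second_difference f x v u d d0.
  move=> s r sd rd; apply: diffs => //; have [] := Hd _ _ (ok _ rd) (ok _ sd).
  by rewrite addrAC.
have [_ [_ H1]] := Hd _ _ (okt _ s1d) (okt _ r1d).
have [_ [H2 _]] := Hd _ _ (okt _ r2d) (okt _ s2d).
rewrite (addrAC x _ (s2 *: v)) in H2.
have E : 'D_u ('D_v f) (x + s2 *: v + r2 *: u) =
         'D_v ('D_u f) (x + s1 *: u + r1 *: v).
  have dN0 : d != 0 by rewrite gt_eqF.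
  apply/(mulIf dN0)/(mulIf dN0).
  have swap (a b c h : R) : a - b - (c - h) = a - c - (b - h) by ring.
  apply: etrans (esym E2) _; apply: etrans E1.
  by rewrite (addrAC x (d *: v) (d *: u)); exact: swap.
rewrite E in H2.
exact: close H2 H1.
Qed.

(** If the second derivative were positive at x, then it would be so on a short
    segment from x; two applications of the mean value theorem would then make f
    increase along that segment. *)
Lemma local_max_derive2 U f (x v : V) : open U -> smooth_on U f -> U x ->
  (forall y, U y -> f y <= f x) -> 'D_v f x = 0 /\ 'D_v ('D_v f) x <= 0.
Proof.
move=> oU sf Ux fmax.
have nU : \near x, U x by exact: open_nbhs_nbhs.
have D1 : 'D_v f x = 0.
  have [d d0 Hd] := near_segment v nU.
  have Ul (s : R) : s \in `]-d, d[ -> U (x + s *: v).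
    by rewrite in_itv -ltr_norml => sd; apply: Hd; exact: ltW.
  have z0 : (0 : R) \in `]-d, d[ by rewrite in_itv /= oppr_lt0 d0.
  have dl (s : R) : s \in `]-d, d[ ->
      is_derive s 1 (fun s : R => f (x + s *: v)) ('D_v f (x + s *: v)).
    by move=> /Ul Us; exact/is_derive_line/(smooth_on_differentiable sf).
  have [] := @derive1_at_max R (fun s : R => f (x + s *: v)) (- d) d 0 _ _ z0.
  - by rewrite ge0_cp // ltW.
  - by move=> s /dl[].
  - by move=> s /Ul Us; rewrite scale0r addr0; exact: fmax.
  - by move=> _; case: (dl _ z0) => _ ->; rewrite scale0r addr0.
split=> //; rewrite leNgt; apply/negP => D2.
have nD : \forall y \near x, 0 < 'D_v ('D_v f) y.
  have : {for x, continuous ('D_v ('D_v f))}.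
    have sD : smooth_on U ('D_v ('D_v f)) by do 2 ! apply: smooth_on_derive.
    exact/differentiable_continuous/(smooth_on_differentiable sD).
  by move/cvgr_gt; apply.
have [d d0 Hd] := near_segment v (filterI nU nD).
have Ul (s : R) : 0 <= s <= d ->
    U (x + s *: v) /\ 0 < 'D_v ('D_v f) (x + s *: v).
  by move=> /andP[s0 sd]; apply: Hd; rewrite ger0_norm.
have [s /andP[s0 sd] E1] : exists2 s, 0 < s < d &
    f (x + d *: v) - f x = 'D_v f (x + s *: v) * d.
  by apply: (@MVT_line f) => // s /Ul[Us _]; exact: smooth_on_differentiable Us.
have [r /andP[r0 rs] E2] : exists2 r, 0 < r < s &
    'D_v f (x + s *: v) - 'D_v f x = 'D_v ('D_v f) (x + r *: v) * s.
  apply: (@MVT_line ('D_v f)) => // r /andP[r0 rs].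
  have [|Ur _] := Ul r; first by rewrite r0 (le_trans rs) ?ltW.
  have sD : smooth_on U ('D_v f) by exact: smooth_on_derive.
  exact: smooth_on_differentiable sD Ur.
have [Ud _] : U (x + d *: v) /\ 0 < 'D_v ('D_v f) (x + d *: v).
  by apply: Ul; rewrite lexx ltW.
have [_ Dr] : U (x + r *: v) /\ 0 < 'D_v ('D_v f) (x + r *: v).
  by apply: Ul; rewrite !ltW // (lt_trans rs).
have := fmax _ Ud; rewrite leNgt -subr_gt0 E1 => /negP; apply.
by apply: mulr_gt0 => //; have := mulr_gt0 Dr s0; rewrite -E2 D1 subr0.
Qed.

End SecondOrder.

(** * The Euclidean inner product *)

Section DotE.
Context {R : realType} {n : nat}.
Implicit Types u v w : 'rV[R]_n.

Lemma dotEC u v : dotE u v = dotE v u.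
Proof. by rewrite !dotEE; apply: eq_bigr => i _; rewrite mulrC. Qed.

Lemma dotEDl u v w : dotE (u + v) w = dotE u w + dotE v w.
Proof. by rewrite /dotE mulmxDl mxE. Qed.

Lemma dotEZl c u v : dotE (c *: u) v = c * dotE u v.
Proof. by rewrite /dotE -scalemxAl mxE. Qed.

Lemma dotEBl u v w : dotE (u - v) w = dotE u w - dotE v w.
Proof. by rewrite -scaleN1r dotEDl dotEZl mulN1r. Qed.

Lemma dotE0l v : dotE 0 v = 0.
Proof. by rewrite -(scale0r 0) dotEZl mul0r. Qed.

Lemma dotE_suml (I : Type) (r : seq I) (P : pred I) (u : I -> 'rV[R]_n) v :
  dotE (\sum_(i <- r | P i) u i) v = \sum_(i <- r | P i) dotE (u i) v.
Proof.
elim/big_rec2: _ => [|i y z _ <-]; first exact: dotE0l.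
exact: dotEDl.
Qed.

Lemma dotE_ge0 u : 0 <= dotE u u.
Proof. by rewrite dotEE sumr_ge0 // => i _; rewrite -expr2 sqr_ge0. Qed.

Lemma dotE_eq0 u : dotE u u = 0 -> u = 0.
Proof.
rewrite dotEE => /eqP; rewrite psumr_eq0 => [/allP u0|i _]; last first.
  by rewrite -expr2 sqr_ge0.
apply/rowP => i; rewrite mxE; apply/eqP.
by have := u0 i (mem_index_enum i); rewrite /= mulf_eq0 orbb.
Qed.

End DotE.

(** * Derivatives of vector-valued maps *)

Section VectorCalculus.
Context {R : realType} {V : normedModType R}.

Lemma derive_sumf (W : normedModType R) m (f : 'I_m -> V -> W) x v :
  (forall i, derivable (f i) x v) ->
  'D_v (fun y => \sum_(i < m) f i y) x = \sum_(i < m) 'D_v (f i) x.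
Proof.
move=> df; rewrite -(derive_sum df); congr (derive _ x v).
by apply/funext => y; rewrite fct_sumE.
Qed.

Lemma derivable_entry p q (f : V -> 'M[R]_(p, q)) x v i j :
  derivable f x v -> derivable (fun y => f y i j) x v.
Proof. by move=> /derivable_mxP. Qed.

Lemma derivable_scale n (c : V -> R) (f : V -> 'rV[R]_n) x v :
  derivable c x v -> derivable f x v -> derivable (fun y => c y *: f y) x v.
Proof.
move=> dc df; apply/derivable_mxP => i j; under eq_fun do rewrite mxE.
exact: (derivableM dc (derivable_entry df)).
Qed.

Lemma derive_scale n (c : V -> R) (f : V -> 'rV[R]_n) x v :
  derivable c x v -> derivable f x v ->
  'D_v (fun y => c y *: f y) x = 'D_v c x *: f x + c x *: 'D_v f x.
Proof.
move=> dc df; apply/matrixP => i j.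
rewrite (derive_entry _ _ (derivable_scale dc df)).
under eq_fun do rewrite mxE.
apply: etrans (deriveM dc (derivable_entry (i := i) (j := j) df)) _.
rewrite !mxE (derive_entry i j df) addrC.
by apply: congr2 => //; exact: mulrC.
Qed.

Lemma derive_dotE n (f g : V -> 'rV[R]_n) x v :
  derivable f x v -> derivable g x v ->
  'D_v (fun y => dotE (f y) (g y)) x =
  dotE ('D_v f x) (g x) + dotE (f x) ('D_v g x).
Proof.
move=> df dg; under eq_fun do rewrite dotEE.
rewrite derive_sumf => [|i]; last first.
  exact: (derivableM (derivable_entry df) (derivable_entry dg)).
rewrite !dotEE -big_split /=; apply: eq_bigr => i _.
apply: etrans (deriveM (derivable_entry (i := 0) (j := i) df)
  (derivable_entry (i := 0) (j := i) dg)) _.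
rewrite -(derive_entry 0 i df) -(derive_entry 0 i dg) addrC.
by apply: congr2 => //; exact: mulrC.
Qed.

Lemma derive_comp (W W' : normedModType R) (h : V -> W) (f : W -> W') x v :
  differentiable h x -> differentiable f (h x) ->
  'D_v (fun y => f (h y)) x = 'D_('D_v h x) f (h x).
Proof.
move=> dh df; rewrite [LHS]deriveE; last exact: (differentiable_comp dh df).
by rewrite (diff_comp dh df) /= -deriveE // -deriveE.
Qed.

Lemma derive_comm_row n (U : set V) (f : V -> 'rV[R]_n) x u v :
  open U -> smooth_on U f -> U x -> 'D_u ('D_v f) x = 'D_v ('D_u f) x.
Proof.
move=> oU sf Ux; have sD (w : V) : smooth_on U ('D_w f).
  exact: smooth_on_derive.
have dD w w' : derivable ('D_w f) x w' by exact: smooth_on_derivable (sD w) Ux.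
have E (w w' : V) i j :
    ('D_w' ('D_w f) x) i j = 'D_w' ('D_w (fun y => f y i j)) x.
  rewrite derive_entry //; apply: near_eq_derive.
  apply: (open_near_eq oU) Ux => y Uy; apply: derive_entry.
  exact: smooth_on_derivable sf Uy.
apply/matrixP => i j; apply: etrans (E v u i j) _.
apply: etrans _ (esym (E u v i j)).
have sf' := (smooth_on_mxP f oU).1 sf; exact: derive_comm oU (sf' i j) Ux.
Qed.

End VectorCalculus.

Section DirectionalDerivative.
Context {R : realType} {m n : nat}.
Implicit Types (f : 'rV[R]_m -> 'rV[R]_n) (x u v : 'rV[R]_m).

Lemma derive_sum_dir (I : Type) (r : seq I) (P : pred I) f x (c : I -> R)
    (w : I -> 'rV[R]_m) : differentiable f x ->
  'D_(\sum_(i <- r | P i) c i *: w i) f x =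
  \sum_(i <- r | P i) c i *: 'D_(w i) f x.
Proof.
move=> df; rewrite deriveE // linear_sum; apply: eq_bigr => i _.
by rewrite linearZ -deriveE.
Qed.

Lemma deriveD_dir f x u v : differentiable f x ->
  'D_(u + v) f x = 'D_u f x + 'D_v f x.
Proof. by move=> df; rewrite !deriveE // linearD. Qed.

Lemma derive_expand f x u : differentiable f x ->
  'D_u f x = \sum_(k < m) u 0 k *: 'D_(delta_mx 0 k) f x.
Proof. by move=> df; rewrite {1}(row_sum_delta u) derive_sum_dir. Qed.

(** The chain rule for a directional derivative whose direction varies with y.
    Taking h = id gives the derivative of X f for a vector field X; taking for h
    a change of coordinates and for X y its derivative at y gives the
    transformation law of second derivatives. *)
Lemma derive_along (V : normedModType R) (h X : V -> 'rV[R]_m) f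
    (U : set 'rV[R]_m) (x v : V) :
  open U -> smooth_on U f -> U (h x) ->
  differentiable h x -> differentiable X x ->
  'D_v (fun y => 'D_(X y) f (h y)) x =
  'D_('D_v h x) ('D_(X x) f) (h x) + 'D_('D_v X x) f (h x).
Proof.
move=> oU sf Uhx dh dX; have df z : U z -> differentiable f z.
  exact: smooth_on_differentiable.
have sD k : smooth_on U ('D_(delta_mx 0 k) f) by exact: smooth_on_derive.
have dD k : differentiable ('D_(delta_mx 0 k) f) (h x).
  exact: smooth_on_differentiable (sD k) Uhx.
have dDh k : differentiable (fun y => 'D_(delta_mx 0 k) f (h y)) x.
  exact: (differentiable_comp dh (dD k)).
have dDv k : derivable (fun y => 'D_(delta_mx 0 k) f (h y)) x v.
  exact: diff_derivable.
have dDk k w : derivable ('D_(delta_mx 0 k) f) (h x) w.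
  exact: diff_derivable.
have dXv : derivable X x v by exact: diff_derivable.
have dXk k : derivable (fun y => X y 0 k) x v.
  exact: derivable_entry.
have nU : \near x, U (h x).
  by apply: (differentiable_continuous dh); exact: open_nbhs_nbhs.
transitivity ('D_v (fun y => \sum_k X y 0 k *: 'D_(delta_mx 0 k) f (h y)) x).
  apply: near_eq_derive; near=> y; apply: derive_expand; apply: df.
  by near: y.
rewrite derive_sumf => [|k]; last first.
  exact: (derivable_scale (dXk k) (dDv k)).
transitivity (\sum_k ('D_v X x 0 k *: 'D_(delta_mx 0 k) f (h x) +
    X x 0 k *: 'D_('D_v h x) ('D_(delta_mx 0 k) f) (h x))).
  apply: eq_bigr => k _; rewrite (derive_scale (dXk k) (dDv k)).
  by rewrite (derive_entry _ _ dXv) (derive_comp v dh (dD k)).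
rewrite big_split /= addrC; apply: (congr2 (fun a b => a + b)); last first.
  exact: esym (derive_expand _ (df _ Uhx)).
transitivity
  ('D_('D_v h x) (fun z => \sum_k X x 0 k *: 'D_(delta_mx 0 k) f z) (h x)).
  rewrite derive_sumf => [|k]; last first.
    exact: (derivable_scale (derivable_cst _ _ _) (dDk k _)).
  apply: eq_bigr => k _; rewrite (derive_scale (derivable_cst _ _ _) (dDk k _)).
  by rewrite derive_cst scale0r add0r.
apply: near_eq_derive; apply: (open_near_eq oU) Uhx => z Uz.
exact: esym (derive_expand _ (df _ Uz)).
Unshelve. all: by end_near. Qed.

Lemma smooth_on_along (U : set 'rV[R]_m) (X : 'rV[R]_m -> 'rV[R]_m) f :
  open U -> smooth_on U f -> smooth_on U X ->
  smooth_on U (fun y => 'D_(X y) f y).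
Proof.
move=> oU sf sX; have S : smooth_on U
    (fun y => \sum_(k < m) X y 0 k *: 'D_(delta_mx 0 k) f y).
  apply: smooth_on_sum => // k _; apply: smooth_onZ => //.
    exact: (smooth_on_mxP X oU).1.
  exact: smooth_on_derive.
apply: smooth_on_eq S => // y Uy; apply: esym (derive_expand _ _).
exact: smooth_on_differentiable sf Uy.
Qed.

Lemma derive2_expand (U : set 'rV[R]_m) f x u v :
  open U -> smooth_on U f -> U x ->
  'D_u ('D_v f) x = \sum_(k < m) \sum_(l < m)
    (u 0 k * v 0 l) *: 'D_(delta_mx 0 k) ('D_(delta_mx 0 l) f) x.
Proof.
move=> oU sf Ux; have sD w : smooth_on U ('D_w f) by exact: smooth_on_derive.
have dD w : differentiable ('D_w f) x.
  exact: smooth_on_differentiable (sD w) Ux.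
have E k : 'D_(delta_mx 0 k) ('D_v f) x =
    \sum_(l < m) v 0 l *: 'D_(delta_mx 0 k) ('D_(delta_mx 0 l) f) x.
  apply: etrans (derive_comm_row _ _ oU sf Ux) _.
  apply: etrans (derive_expand _ (dD _)) _.
  apply: eq_bigr => l _; apply: (congr1 (fun w => v 0 l *: w)).
  exact: derive_comm_row oU sf Ux.
apply: etrans (derive_expand _ (dD _)) _; apply: eq_bigr => k _.
by rewrite E scaler_sumr; apply: eq_bigr => l _; rewrite scalerA.
Qed.

End DirectionalDerivative.

(** * Linear algebra of inner products *)

Section LinearAlgebra.
Context {R : realType} {m : nat}.
Implicit Types (G : 'M[R]_m) (u v w : 'rV[R]_m).

Lemma dotG_delta G i j : dotG G (delta_mx 0 i) (delta_mx 0 j) = G i j.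
Proof. by rewrite /dotG -rowE trmx_delta -colE !mxE. Qed.

Lemma posdef_unitmx G : (forall u, u != 0 -> 0 < dotG G u u) -> G \in unitmx.
Proof.
move=> pos; rewrite unitmxE unitfE; apply/det0P => -[u u0 uG].
by have := pos u u0; rewrite /dotG uG mul0mx mxE ltxx.
Qed.

Section Frame.
Context (G : 'M[R]_m) (e : 'I_m -> 'rV[R]_m).
Context (e_ortho : forall i j, dotG G (e i) (e j) = (i == j)%:R).

Let B := \matrix_(i < m) e i.

Let BGB : B *m G *m B^T = 1%:M.
Proof.
apply/matrixP => i j; rewrite [RHS]mxE -e_ortho /dotG !mxE.
apply: eq_bigr => k _; rewrite !mxE; congr (_ * _).
by apply: eq_bigr => l _; rewrite !mxE.
Qed.

Let GBB : G *m (B^T *m B) = 1%:M.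
Proof. by rewrite mulmxA; apply: mulmx1C; rewrite mulmxA. Qed.

(** The matrix B of the frame satisfies B G B^T = 1, hence also G (B^T B) = 1
    because one-sided inverses of square matrices are two-sided. *)
Lemma frame_expand w : w = \sum_(j < m) dotG G w (e j) *: e j.
Proof.
rewrite -{1}[w]mulmx1 -GBB !mulmxA mulmx_sum_row; apply: eq_bigr => j _.
rewrite rowK; congr (_ *: _); rewrite /dotG !mxE; apply: eq_bigr => k _.
by rewrite !mxE.
Qed.

(** The sum on the left is an entry of B^T B, which is the inverse of G; it
    is therefore the same for all orthonormal frames. *)
Lemma frame_invmx k l : \sum_(i < m) e i 0 k * e i 0 l = invmx G k l.
Proof.
have -> : invmx G = B^T *m B.
  have [Gu _] := mulmx1_unit GBB.
  by rewrite -[LHS]mulmx1 -GBB mulKmx.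
by rewrite mxE; apply: eq_bigr => i _; rewrite !mxE.
Qed.

End Frame.

(** Exchanging the first two and the last two indices generates all permutations
    of three indices, and the braid relation between these exchanges forces
    A = - A. This is the uniqueness of the Levi-Civita connection. *)
Lemma braid_eq0 (A : 'I_m -> 'I_m -> 'I_m -> R) :
  (forall i j l, A i j l = A j i l) -> (forall i j l, A i j l = - A i l j) ->
  forall i j l, A i j l = 0.
Proof.
move=> sA aA i j l; have E : A i j l = - A i j l.
  by rewrite {1}sA aA sA aA opprK sA aA.
by move: E; set a := A i j l => E; lra.
Qed.

End LinearAlgebra.

(** * Isometric coordinate patches *)

(** The zeroth-order part of [levi_civita], as a bilinear map of two tangent
    vectors. *)
Definition christoffel_form (R : realType) (m : nat) (G : 'rV[R]_m -> 'M[R]_m)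
    (x u v : 'rV[R]_m) : 'rV[R]_m :=
  \row_(k < m) \sum_(i < m) \sum_(j < m) christoffel G x k i j * u 0 i * v 0 j.

(** The coordinate expression of an isometric immersion in one chart; the
    isometry condition is put in terms of directional derivatives because all
    computations below differentiate it. *)
Record isometric_patch (R : realType) (m n : nat) (U : set 'rV[R]_m)
    (G : 'rV[R]_m -> 'M[R]_m) (F : 'rV[R]_m -> 'rV[R]_n) : Prop :=
  IsometricPatch {
    patch_open : open U ;
    patch_smoothG : smooth_on U G ;
    patch_sym : forall x, U x -> (G x)^T = G x ;
    patch_pos : forall x, U x -> forall u, u != 0 -> 0 < dotG (G x) u u ;
    patch_smoothF : smooth_on U F ;
    patch_isom : forall x, U x -> forall u v,
      dotE ('D_u F x) ('D_v F x) = dotG (G x) u v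
  }.

Section Patch.
Context {R : realType} {m n : nat} {U : set 'rV[R]_m}.
Context {G : 'rV[R]_m -> 'M[R]_m} {F : 'rV[R]_m -> 'rV[R]_n}.
Context (GF : isometric_patch U G F).

Let oU : open U := patch_open GF.
Let sF : smooth_on U F := patch_smoothF GF.

Lemma patch_diff x : U x -> differentiable F x.
Proof. exact: smooth_on_differentiable sF. Qed.

Lemma patch_diffD u x : U x -> differentiable ('D_u F) x.
Proof.
have sD : smooth_on U ('D_u F) by exact: smooth_on_derive.
exact: smooth_on_differentiable sD.
Qed.

Lemma metric_entry x i j : U x ->
  dotE ('D_(delta_mx 0 i) F x) ('D_(delta_mx 0 j) F x) = G x i j.
Proof. by move=> Ux; rewrite (patch_isom GF Ux) dotG_delta. Qed.

(** The tangential part of the second derivatives of F is given by the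
    Christoffel symbols. Indeed the products <F_ij, F_l> are symmetric in i
    and j and satisfy the Leibniz rule for the derivatives of <F_i, F_j> = G
    i j; the lowered Christoffel symbols have the same two properties, so
    the difference vanishes by [braid_eq0]. *)
Lemma christoffel_normal x i j l : U x ->
  dotE ('D_(delta_mx 0 i) ('D_(delta_mx 0 j) F) x) ('D_(delta_mx 0 l) F x) =
  \sum_(k < m) christoffel G x k i j * G x k l.
Proof.
move=> Ux; have nU : \near x, U x by exact: open_nbhs_nbhs.
have nsym : \forall y \near x, (G y)^T = G y.
  by near=> y; apply: (patch_sym GF); near: y.
have Gs p q : G x p q = G x q p by rewrite -[in LHS](patch_sym GF Ux) mxE.
have Gu : G x \in unitmx by exact/posdef_unitmx/(patch_pos GF).
pose A i j l : R :=
  dotE ('D_(delta_mx 0 i) ('D_(delta_mx 0 j) F) x) ('D_(delta_mx 0 l) F x) -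
  \sum_(k < m) christoffel G x k i j * G x k l.
suff A0 : forall i j l, A i j l = 0.
  by apply/eqP; rewrite -subr_eq0; apply/eqP; exact: A0.
apply: braid_eq0 => {}i {}j {}l; rewrite /A.
  apply: (congr2 (fun a b => a - b)).
    apply: (congr1 (fun a => dotE a _)); exact: derive_comm_row oU sF Ux.
  by apply: eq_bigr => k _; rewrite (christoffel_torsion_free _ _ _ nsym).
have dF w w' : derivable ('D_w F) x w'.
  by apply: diff_derivable; exact: patch_diffD.
have E1 : dmetric G x i j l =
    dotE ('D_(delta_mx 0 i) ('D_(delta_mx 0 j) F) x) ('D_(delta_mx 0 l) F x) +
    dotE ('D_(delta_mx 0 j) F x) ('D_(delta_mx 0 i) ('D_(delta_mx 0 l) F) x).
  apply: etrans (derive_dotE (dF _ _) (dF _ _)); apply: near_eq_derive.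
  by apply: (open_near_eq oU) Ux => y Uy; apply: esym (metric_entry _ _ Uy).
have E2 := etrans (christoffel_metric i j l nsym Gu) (big_split _ _ _ _ _).
have rearrange (a b s t b' t' : R) : a + b = s + t -> b = b' -> t = t' ->
    a - s = - (b' - t').
  move=> ab <- <-; apply/eqP.
  by rewrite opprB subr_eq addrAC -subr_eq opprK ab addrC.
apply: (rearrange _ _ _ _ _ _ (etrans (esym E1) E2) (dotEC _ _)).
by apply: eq_bigr => k _; rewrite (Gs j k).
Unshelve. all: by end_near. Qed.

End Patch.

(** * The tension field in a coordinate patch *)

Section SecondFundamentalForm.
Context {R : realType} {m n : nat} {U : set 'rV[R]_m}.
Context {G : 'rV[R]_m -> 'M[R]_m} {F : 'rV[R]_m -> 'rV[R]_n}.
Context (GF : isometric_patch U G F).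

Let oU : open U := patch_open GF.
Let sF : smooth_on U F := patch_smoothF GF.

(** The Gauss formula: what remains of the second derivative of F once the
    covariant derivative is taken away is normal to the submanifold. *)
Lemma second_fundamental_form_normal x u v w : U x ->
  dotE ('D_u ('D_v F) x - 'D_(christoffel_form G x u v) F x) ('D_w F x) = 0.
Proof.
move=> Ux; have dF := patch_diff GF Ux.
pose row_chr i j : 'rV[R]_m := \row_k christoffel G x k i j.
(* The normal parts of the second coordinate derivatives. *)
pose N i j :=
  'D_(delta_mx 0 i) ('D_(delta_mx 0 j) F) x - 'D_(row_chr i j) F x.
have N0 i j : dotE (N i j) ('D_w F x) = 0.
  rewrite (derive_expand w dF) dotEC dotE_suml big1 // => l _.
  rewrite dotEZl dotEC dotEBl (christoffel_normal GF) //.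
  rewrite (derive_expand _ dF) dotE_suml.
  under [X in _ - X]eq_bigr => k _ do rewrite dotEZl (metric_entry GF) // mxE.
  by rewrite subrr mulr0.
have chrE : christoffel_form G x u v =
    \sum_(p : 'I_m * 'I_m) (u 0 p.1 * v 0 p.2) *: row_chr p.1 p.2.
  rewrite -(pair_bigA _ (fun i j => (u 0 i * v 0 j) *: row_chr i j)) /=.
  apply/rowP => k; rewrite mxE summxE; apply: eq_bigr => i _.
  rewrite summxE; apply: eq_bigr => j _.
  by rewrite !mxE -mulrA mulrC.
have -> : 'D_u ('D_v F) x - 'D_(christoffel_form G x u v) F x =
    \sum_(p : 'I_m * 'I_m) (u 0 p.1 * v 0 p.2) *: N p.1 p.2.
  rewrite (derive2_expand _ _ oU sF Ux) chrE (derive_sum_dir _ _ _ _ dF).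
  rewrite (pair_bigA _ (fun i j => (u 0 i * v 0 j) *:
    'D_(delta_mx 0 i) ('D_(delta_mx 0 j) F) x)) /=.
  by rewrite -sumrB; apply: eq_bigr => p _; rewrite -scalerBr.
by rewrite dotE_suml big1 // => p _; rewrite dotEZl N0 mulr0.
Qed.

Context {E : 'I_m -> 'rV[R]_m -> 'rV[R]_m} (oE : orthonormal_frame G U E).

Let sE i : smooth_on U (E i) := oE.1 i.

Lemma frame_diff i x : U x -> differentiable (E i) x.
Proof. exact: smooth_on_differentiable (sE i). Qed.

Lemma derive_along_id (f : 'rV[R]_m -> 'rV[R]_n) i x v : smooth_on U f ->
  U x -> 'D_v (fun y => 'D_(E i y) f y) x =
         'D_v ('D_(E i x) f) x + 'D_('D_v (E i) x) f x.
Proof.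
move=> sf Ux; have did : differentiable (id : 'rV[R]_m -> 'rV[R]_m) x by [].
have D := @derive_along R m n _ id (E i) f U x v oU sf Ux did (frame_diff i Ux).
by rewrite derive_id in D.
Qed.

(** The tension field is the Laplacian of the immersion itself; this is what
    relates the size of F at a maximum of |F|^2 to tau. *)
Lemma tension_field_laplacian x : U x ->
  tension_field G E F x = - rough_laplacian G E F x.
Proof.
move=> Ux; rewrite /rough_laplacian opprK; apply: eq_bigr => i _.
apply: (congr2 (fun a b => a - b)).
  apply: near_eq_derive; apply: (open_near_eq oU) Ux => y Uy.
  exact: esym (deriveE _ (patch_diff GF Uy)).
exact: esym (deriveE _ (patch_diff GF Ux)).
Qed.

(** The derivative of the frame enters both D_(E i) (D_(E i) F) and the
    Levi-Civita term, and cancels. *)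
Lemma tension_field_trace x : U x ->
  tension_field G E F x = \sum_(i < m) ('D_(E i x) ('D_(E i x) F) x -
    'D_(christoffel_form G x (E i x) (E i x)) F x).
Proof.
move=> Ux; rewrite tension_field_laplacian // /rough_laplacian opprK.
apply: eq_bigr => i _; rewrite /nabla_along.
apply: etrans (congr2 (fun a b => a - b) (derive_along_id i _ sF Ux)
  (deriveD_dir _ _ (patch_diff GF Ux))) _.
exact: addrKA.
Qed.

Lemma tension_field_normal x w : U x ->
  dotE (tension_field G E F x) ('D_w F x) = 0.
Proof.
move=> Ux; rewrite tension_field_trace // dotE_suml big1 // => i _.
exact: second_fundamental_form_normal.
Qed.

Lemma orthonormal_tangent x i j : U x ->
  dotE ('D_(E i x) F x) ('D_(E j x) F x) = (i == j)%:R.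
Proof. by move=> Ux; rewrite (patch_isom GF Ux); exact: oE.2. Qed.

Lemma tangent_expand x w : U x -> 'D_w F x =
  \sum_(j < m) dotE ('D_w F x) ('D_(E j x) F x) *: 'D_(E j x) F x.
Proof.
move=> Ux; rewrite {1}(frame_expand (oE.2 x Ux) w).
rewrite (derive_sum_dir _ _ _ _ (patch_diff GF Ux)); apply: eq_bigr => j _.
by rewrite (patch_isom GF Ux).
Qed.

(** S differs from the tension field by a tangent vector, and the tension field
    is normal, so the latter is the normal projection of S. In this form only F
    and the frame occur, and no inverse of the metric matrix. *)
Lemma tension_field_projection x : U x ->
  let S := \sum_(i < m) 'D_(E i x) (fun y => 'D_(E i y) F y) x in
  tension_field G E F x =
  S - \sum_(j < m) dotE S ('D_(E j x) F x) *: 'D_(E j x) F x.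
Proof.
move=> Ux S; pose z := \sum_(i < m) levi_civita G (E i) (E i) x.
have TE : tension_field G E F x = S - 'D_z F x.
  rewrite tension_field_laplacian // /rough_laplacian opprK sumrB.
  apply: (congr1 (fun a => S - a)).
  apply: etrans _ (esym (deriveE z (patch_diff GF Ux))).
  rewrite linear_sum; apply: eq_bigr => i _.
  exact: deriveE (patch_diff GF Ux).
rewrite [LHS]TE (tangent_expand z Ux).
apply: (congr1 (fun a => S - a)); apply: eq_bigr => j _.
apply: (congr1 (fun c => c *: _)); apply/eqP; rewrite eq_sym -subr_eq0 -dotEBl.
by rewrite -TE tension_field_normal.
Qed.

Lemma tension_field_smooth : smooth_on U (tension_field G E F).
Proof.
have sD i : smooth_on U (fun y => 'D_(E i y) F y) by exact: smooth_on_along.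
have sS : smooth_on U
    (fun x => \sum_(i < m) 'D_(E i x) (fun y => 'D_(E i y) F y) x).
  by apply: smooth_on_sum => // i _; exact: smooth_on_along.
apply: smooth_on_eq (fun x Ux => esym (tension_field_projection Ux)) _ => //.
apply: smooth_onB => //; apply: smooth_on_sum => // j _.
by apply: smooth_onZ => //; exact: smooth_on_dotE.
Qed.

(** The function q = |f|^2 has vanishing first and nonpositive second
    derivatives at x. Hence D_v f x is orthogonal to f x for every v, so the
    terms with derivatives of the frame and with the connection drop out of
    <Lap f, f> + sum_i |D_(E i) f|^2, and the rest is half a sum of second
    derivatives of q. *)
Lemma laplacian_at_local_max (f : 'rV[R]_m -> 'rV[R]_n) x :
  smooth_on U f -> U x ->
  (forall y, U y -> dotE (f y) (f y) <= dotE (f x) (f x)) ->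
  \sum_(i < m) dotE ('D_(E i x) f x) ('D_(E i x) f x) <=
  dotE (rough_laplacian G E f x) (f x).
Proof.
move=> sf Ux fmax; pose q y := dotE (f y) (f y).
have sq : smooth_on U q by exact: smooth_on_dotE.
have df y v : U y -> derivable f y v by exact: smooth_on_derivable sf.
have Dq v y : U y -> 'D_v q y = 2 * dotE ('D_v f y) (f y).
  move=> Uy; apply: etrans (derive_dotE (df y v Uy) (df y v Uy)) _.
  by rewrite [X in _ + X]dotEC mulr2n mulrDl mul1r.
have crit v : dotE ('D_v f x) (f x) = 0.
  have [+ _] := local_max_derive2 v oU sq Ux fmax.
  by rewrite Dq // => /eqP; rewrite mulf_eq0 pnatr_eq0 => /eqP.
have second v : dotE ('D_v ('D_v f) x) (f x) + dotE ('D_v f x) ('D_v f x) <= 0.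
  have [_ +] := local_max_derive2 v oU sq Ux fmax.
  have sDf : smooth_on U ('D_v f) by exact: smooth_on_derive.
  have -> : 'D_v ('D_v q) x =
      'D_v (fun y => 2 * dotE ('D_v f y) (f y)) x.
    apply: near_eq_derive; apply: (open_near_eq oU) Ux => y Uy; exact: Dq.
  have dDf : derivable ('D_v f) x v by exact: smooth_on_derivable sDf Ux.
  have -> : 'D_v (fun y => 2 * dotE ('D_v f y) (f y)) x =
      2 * (dotE ('D_v ('D_v f) x) (f x) + dotE ('D_v f x) ('D_v f x)).
    have sDE : smooth_on U (fun y => dotE ('D_v f y) (f y)).
      exact: smooth_on_dotE.
    apply: etrans (deriveMl 2 (smooth_on_derivable sDE Ux)) _.
    exact: (congr1 (fun a : R => 2 * a) (derive_dotE dDf (df x v Ux))).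
  by rewrite pmulr_rle0.
rewrite /rough_laplacian -scaleN1r dotEZl mulN1r -subr_ge0 -opprD oppr_ge0.
rewrite dotE_suml -big_split /=; apply: sumr_le0 => i _.
rewrite dotEBl /nabla_along crit subr0 (derive_along_id i _ sf Ux).
by rewrite dotEDl crit addr0; exact: second.
Qed.

End SecondFundamentalForm.

(** * The tension field at maxima *)

Section TensionAtMaxima.
Context {R : realType} {m n : nat} {U : set 'rV[R]_m}.
Context {G : 'rV[R]_m -> 'M[R]_m} {F : 'rV[R]_m -> 'rV[R]_n}.
Context (GF : isometric_patch U G F).
Context {E : 'I_m -> 'rV[R]_m -> 'rV[R]_m} (oE : orthonormal_frame G U E).

Let oU : open U := patch_open GF.
Let sF : smooth_on U F := patch_smoothF GF.
Let tau := tension_field G E F.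

(** Differentiating <tau, D_(E i) F> = 0 along E i gives
    <tau, D_(E i) (D_(E i) F)> = 0 wherever tau is parallel; summed over i, this
    says that tau is orthogonal to a vector of which it is the normal part. *)
Lemma tension_eq0_of_parallel x : U x ->
  (forall i, 'D_(E i x) tau x = 0) -> tau x = 0.
Proof.
move=> Ux tau_par; apply: dotE_eq0.
have st : smooth_on U tau := tension_field_smooth GF oE.
have sDE i : smooth_on U (fun y => 'D_(E i y) F y).
  by apply: smooth_on_along => //; exact: oE.1.
pose S := \sum_(i < m) 'D_(E i x) (fun y => 'D_(E i y) F y) x.
(* Each summand is the derivative of <tau, D_(E i) F> = 0 along E i, because
   D_(E i) tau = 0. *)
have tauS : dotE (tau x) S = 0.
  rewrite dotEC dotE_suml big1 // => i _; rewrite dotEC.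
  have D := derive_dotE (smooth_on_derivable (v := E i x) st Ux)
    (smooth_on_derivable (sDE i) Ux).
  rewrite tau_par dotE0l add0r in D; apply: etrans (esym D) _.
  apply: etrans (derive_cst (0 : R) x (E i x)); apply: near_eq_derive.
  by apply: (open_near_eq oU) Ux => y Uy; exact: (tension_field_normal GF oE).
rewrite {1}/tau (tension_field_projection GF oE Ux) dotEBl -/S.
rewrite [X in X - _]dotEC -/tau tauS sub0r dotE_suml big1 ?oppr0 // => j _.
by rewrite dotEZl [X in _ * X]dotEC (tension_field_normal GF oE _ Ux) mulr0.
Qed.

Lemma tension_eq0_at_max x : U x -> rough_laplacian G E tau x = 0 ->
  (forall y, U y -> dotE (tau y) (tau y) <= dotE (tau x) (tau x)) ->
  tau x = 0.
Proof.
move=> Ux tau_harm tau_max; apply: (tension_eq0_of_parallel Ux) => i.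
have := laplacian_at_local_max GF oE (tension_field_smooth GF oE) Ux tau_max.
rewrite tau_harm dotE0l => le0; apply: dotE_eq0; apply/eqP.
have ge0 j : true -> 0 <= dotE ('D_(E j x) tau x) ('D_(E j x) tau x).
  by move=> _; exact: dotE_ge0.
have : \sum_(j < m) dotE ('D_(E j x) tau x) ('D_(E j x) tau x) == 0.
  by rewrite eq_le le0 sumr_ge0.
by rewrite (psumr_eq0 _ ge0) => /allP/(_ i (mem_index_enum i)).
Qed.

(** Since |D_(E i) F|^2 = 1, the Laplacian inequality for F reads
    m <= - <tau x, F x>. *)
Lemma tension_neq0_at_max x : (0 < m)%N -> U x ->
  (forall y, U y -> dotE (F y) (F y) <= dotE (F x) (F x)) -> tau x != 0.
Proof.
move=> m_gt0 Ux F_max; apply/eqP => tau0.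
have := laplacian_at_local_max GF oE sF Ux F_max.
have -> : rough_laplacian G E F x = 0.
  apply/eqP; rewrite -oppr_eq0; apply/eqP.
  by rewrite -(tension_field_laplacian GF).
rewrite dotE0l.
under eq_bigr => i _ do rewrite (orthonormal_tangent GF oE) // eqxx.
by rewrite sumr_const card_ord leNgt ltr0n m_gt0.
Qed.

End TensionAtMaxima.

(** * Independence of the chart and the frame *)

Section ChartInvariance.
Context {R : realType} {m n : nat}.

(** Only products of frame coefficients summed over the frame occur in the trace
    of the second derivative, and [frame_invmx] computes these. *)
Lemma hessian_trace (U : set 'rV[R]_m) (G : 'M[R]_m) (e : 'I_m -> 'rV[R]_m)
    (f : 'rV[R]_m -> 'rV[R]_n) x :
  open U -> smooth_on U f -> U x ->
  (forall i j, dotG G (e i) (e j) = (i == j)%:R) ->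
  \sum_(i < m) 'D_(e i) ('D_(e i) f) x = \sum_(k < m) \sum_(l < m)
    invmx G k l *: 'D_(delta_mx 0 k) ('D_(delta_mx 0 l) f) x.
Proof.
move=> oU sf Ux oe.
under eq_bigr => i _ do rewrite (derive2_expand _ _ oU sf Ux).
rewrite exchange_big; apply: eq_bigr => k _; rewrite exchange_big.
apply: eq_bigr => l _; rewrite -(frame_invmx oe) scaler_suml.
exact: eq_bigr.
Qed.

Context {U1 U2 : set 'rV[R]_m} {G1 G2 : 'rV[R]_m -> 'M[R]_m}.
Context {F1 F2 : 'rV[R]_m -> 'rV[R]_n}.
Context (P1 : isometric_patch U1 G1 F1) (P2 : isometric_patch U2 G2 F2).
Context {E1 E2 : 'I_m -> 'rV[R]_m -> 'rV[R]_m}.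
Context (oE1 : orthonormal_frame G1 U1 E1) (oE2 : orthonormal_frame G2 U2 E2).

(** By the chain rule the second derivatives of F1 and of F2 differ by
    tangent vectors, and their traces agree because the derivative of psi
    maps E1 to an orthonormal frame of G2. So the two tension fields differ
    by a tangent vector, while both are normal to the common tangent space. *)
Lemma tension_field_reparam (W : set 'rV[R]_m) (psi : 'rV[R]_m -> 'rV[R]_m) x :
  open W -> W `<=` U1 -> (forall y, W y -> U2 (psi y)) -> smooth_on W psi ->
  (forall y, W y -> F1 y = F2 (psi y)) ->
  G1 x = jacobian psi x *m G2 (psi x) *m (jacobian psi x)^T ->
  W x -> tension_field G1 E1 F1 x = tension_field G2 E2 F2 (psi x).
Proof.
move=> oW WU1 WU2 spsi F12 G12 Wx; have Ux := WU1 x Wx; have Upx := WU2 x Wx.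
have dpsi y : W y -> differentiable psi y by exact: smooth_on_differentiable.
have DF u y : W y -> 'D_u F1 y = 'D_('D_u psi y) F2 (psi y).
  move=> Wy.
  apply: etrans (derive_comp u (dpsi y Wy) (patch_diff P2 (WU2 y Wy))).
  by apply: near_eq_derive; exact: (open_near_eq oW) Wy.
have sDpsi v : smooth_on W ('D_v psi) by exact: smooth_on_derive.
have DDF u v : 'D_u ('D_v F1) x =
    'D_('D_u psi x) ('D_('D_v psi x) F2) (psi x) +
    'D_('D_u ('D_v psi) x) F2 (psi x).
  apply: etrans (derive_along u (patch_open P2) (patch_smoothF P2) Upx
    (dpsi x Wx) (smooth_on_differentiable (sDpsi v) Wx)).
  by apply: near_eq_derive; apply: (open_near_eq oW) Wx => y Wy; exact: DF.
have oe i j : dotG (G2 (psi x)) ('D_(E1 i x) psi x) ('D_(E1 j x) psi x) =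
    (i == j)%:R.
  apply: etrans (esym (patch_isom P2 Upx _ _)) _.
  apply: etrans (congr2 (fun u v => dotE u v) (esym (DF (E1 i x) x Wx))
    (esym (DF (E1 j x) x Wx))) _.
  exact: (orthonormal_tangent P1 oE1).
(* The metrics are nondegenerate, so the Jacobian of psi is invertible and the
   two tangent spaces coincide. *)
have tangent z : exists z', 'D_z F2 (psi x) = 'D_z' F1 x.
  have : G1 x \in unitmx by exact/posdef_unitmx/(patch_pos P1).
  rewrite G12 !unitmx_mul => /andP[/andP[Ju _] _].
  exists (z *m invmx (jacobian psi x)); apply: etrans (esym (DF _ x Wx)).
  apply: (congr1 (fun v => 'D_v F2 (psi x))).
  by rewrite (deriveEjacobian _ (dpsi x Wx)) mulmxKV.
have [z tauE] : exists z, tension_field G1 E1 F1 x -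
    tension_field G2 E2 F2 (psi x) = 'D_z F2 (psi x).
  have dF2 := patch_diff P2 Upx.
  pose a i := 'D_('D_(E1 i x) ('D_(E1 i x) psi) x) F2 (psi x).
  pose b i :=
    'D_('D_(christoffel_form G1 x (E1 i x) (E1 i x)) psi x) F2 (psi x).
  pose c i := 'D_(christoffel_form G2 (psi x) (E2 i (psi x)) (E2 i (psi x))) F2
    (psi x).
  pose h1 i := 'D_('D_(E1 i x) psi x) ('D_('D_(E1 i x) psi x) F2) (psi x).
  pose h2 i := 'D_(E2 i (psi x)) ('D_(E2 i (psi x)) F2) (psi x).
  have tau1 : tension_field G1 E1 F1 x = \sum_i (h1 i + a i - b i).
    apply: etrans (tension_field_trace P1 oE1 Ux) _; apply: eq_bigr => i _.
    have ea : 'D_(E1 i x) ('D_(E1 i x) F1) x = h1 i + a i by exact: DDF.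
    have eb : 'D_(christoffel_form G1 x (E1 i x) (E1 i x)) F1 x = b i.
      exact: DF _ _ Wx.
    exact: (congr2 (fun u v : 'rV[R]_n => u - v) ea eb).
  have tau2 : tension_field G2 E2 F2 (psi x) = \sum_i (h2 i - c i).
    exact: (tension_field_trace P2 oE2 Upx).
  have h12 : \sum_i h1 i = \sum_i h2 i.
    apply: etrans (hessian_trace (patch_open P2) (patch_smoothF P2) Upx oe) _.
    exact: esym (hessian_trace (patch_open P2) (patch_smoothF P2) Upx
      (oE2.2 _ Upx)).
  exists (\sum_i ('D_(E1 i x) ('D_(E1 i x) psi) x -
    'D_(christoffel_form G1 x (E1 i x) (E1 i x)) psi x +
    christoffel_form G2 (psi x) (E2 i (psi x)) (E2 i (psi x)))).
  apply: etrans _ (esym (deriveE _ dF2)); rewrite [RHS]linear_sum.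
  transitivity (\sum_i (a i - b i + c i)).
    rewrite tau1 tau2; clearbody a b c h1 h2; rewrite !big_split /=.
    by rewrite !sumrN h12; apply/rowP => j; rewrite !mxE; ring.
  apply: eq_bigr => i _; rewrite [RHS]linearD linearB /a /b /c.
  by rewrite !(deriveE _ dF2).
apply/eqP; rewrite -subr_eq0; apply/eqP; apply: dotE_eq0.
rewrite {2}tauE dotEBl (tension_field_normal P2 oE2 _ Upx) subr0.
by have [z' ->] := tangent z; exact: (tension_field_normal P1 oE1).
Qed.

End ChartInvariance.

(** * Smooth orthonormal frames *)

Section GramSchmidt.
Context {R : realType} {m : nat}.

Lemma dotGDl (G : 'M[R]_m) u v w : dotG G (u + v) w = dotG G u w + dotG G v w.
Proof. by rewrite /dotG !mulmxDl mxE. Qed.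

Lemma dotGZl (G : 'M[R]_m) c u v : dotG G (c *: u) v = c * dotG G u v.
Proof. by rewrite /dotG -!scalemxAl mxE. Qed.

Lemma dotGC (G : 'M[R]_m) u v : G^T = G -> dotG G u v = dotG G v u.
Proof.
move=> symG; rewrite /dotG -[in LHS](trmxK (u *m G *m v^T)) [LHS]mxE.
by rewrite !trmx_mul trmxK symG mulmxA.
Qed.

Lemma dotG_suml (G : 'M[R]_m) (I : Type) (r : seq I) (P : pred I)
    (u : I -> 'rV[R]_m) v :
  dotG G (\sum_(i <- r | P i) u i) v = \sum_(i <- r | P i) dotG G (u i) v.
Proof.
elim/big_rec2: _ => [|i y z _ <-]; last exact: dotGDl.
by rewrite /dotG !mul0mx mxE.
Qed.

Lemma smooth_on_dotG (U : set 'rV[R]_m) (G : 'rV[R]_m -> 'M[R]_m)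
    (f g : 'rV[R]_m -> 'rV[R]_m) : open U -> smooth_on U G ->
  smooth_on U f -> smooth_on U g ->
  smooth_on U (fun x => dotG (G x) (f x) (g x)).
Proof.
move=> oU sG sf sg.
have smG := (smooth_on_mxP G oU).1 sG; have smf := (smooth_on_mxP f oU).1 sf.
have sfG : smooth_on U (fun x => f x *m G x).
  apply/(smooth_on_mxP _ oU) => i j; under eq_fun do rewrite mxE.
  by apply: smooth_on_sum => // k _; apply: smooth_onM.
exact: smooth_on_dotE oU sfG sg.
Qed.

(** Gram-Schmidt applied to the coordinate fields. The frame is kept
    triangular: E i has no component beyond the i-th. Then the next
    orthogonalized field has a coordinate equal to 1, so it vanishes nowhere
    on U and can be normalized. *)
Lemma orthonormal_frame_exists (U : set 'rV[R]_m) (G : 'rV[R]_m -> 'M[R]_m) :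
  open U -> smooth_on U G -> (forall x, U x -> (G x)^T = G x) ->
  (forall x, U x -> forall u, u != 0 -> 0 < dotG (G x) u u) ->
  exists E, orthonormal_frame G U E.
Proof.
move=> oU sG symG posG.
suff /(_ m (leqnn m))[E [sE oE _]] : forall k, (k <= m)%N ->
    exists E : 'I_m -> 'rV[R]_m -> 'rV[R]_m,
    [/\ forall i : 'I_m, (i < k)%N -> smooth_on U (E i),
        forall x, U x -> forall i j : 'I_m, (i < k)%N -> (j < k)%N ->
          dotG (G x) (E i x) (E j x) = (i == j)%:R &
        forall x (i l : 'I_m), (i < k)%N -> (i < l)%N -> E i x 0 l = 0].
  exists E; split=> [i|x Ux i j]; first exact/sE/ltn_ord.
  by apply: oE => //; exact: ltn_ord.
elim=> [|k IH] km; first by exists (fun _ _ => 0); split.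
have [E [sE oE tE]] := IH (ltnW km); pose o := Ordinal km.
pose w x : 'rV[R]_m := delta_mx 0 o -
  \sum_(j < m | (j < k)%N) dotG (G x) (delta_mx 0 o) (E j x) *: E j x.
have sw : smooth_on U w.
  apply: smooth_onB => //; first exact: smooth_on_cst.
  apply: smooth_on_sum => // j jk; apply: smooth_onZ => //; last exact: sE.
  by apply: smooth_on_dotG => //; [exact: smooth_on_cst|exact: sE].
(* The fields already constructed have no component along o. *)
have wo x : w x 0 o = 1.
  rewrite !mxE !eqxx summxE big1 ?subr0 // => j jk.
  by rewrite mxE (tE x j o) ?mulr0.
have w_pos x : U x -> 0 < dotG (G x) (w x) (w x).
  move=> Ux; apply: posG => //; apply/eqP => w0.
  by have /eqP := wo x; rewrite w0 mxE eq_sym oner_eq0.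
have wE x (i : 'I_m) : U x -> (i < k)%N -> dotG (G x) (w x) (E i x) = 0.
  move=> Ux ik; rewrite dotGDl -scaleN1r dotGZl dotG_suml mulN1r.
  rewrite (bigD1 i) //= big1 => [|j /andP[jk ji]]; last first.
    by rewrite dotGZl oE // (negbTE ji) mulr0.
  by rewrite dotGZl oE // eqxx mulr1 addr0 subrr.
pose c x := (Num.sqrt (dotG (G x) (w x) (w x)))^-1.
have sc : smooth_on U c.
  by apply: smooth_on_invsqrt => //; exact: smooth_on_dotG.
have lt_k (i : 'I_m) : (i < k.+1)%N -> i != o -> (i < k)%N.
  by rewrite ltnS leq_eqVlt => /orP[/eqP ik /eqP[]|//]; exact: val_inj.
exists (fun i => if i == o then fun x => c x *: w x else E i); split.
- move=> i ik; case: eqVneq => [_|io]; first exact: smooth_onZ.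
  exact/sE/lt_k.
- move=> x Ux i j ik jk; have Gx := symG x Ux.
  case: (eqVneq i o) => [io|io]; case: (eqVneq j o) => [jo|jo].
  + rewrite io jo eqxx dotGZl dotGC // dotGZl /c.
    rewrite -[X in _ * (_ * X)]sqr_sqrtr; last exact/ltW/w_pos.
    have s0 : Num.sqrt (dotG (G x) (w x) (w x)) != 0.
      by rewrite gt_eqF // sqrtr_gt0 w_pos.
    by rewrite expr2 mulKf // mulVf.
  + by rewrite io dotGZl wE ?mulr0 ?(lt_k j) // eq_sym (negbTE jo).
  + by rewrite jo dotGC // dotGZl wE ?mulr0 ?(lt_k i) // (negbTE io).
  + by apply: oE => //; exact: lt_k.
- move=> x i l ik il; case: (eqVneq i o) il => [->|io] il; last first.
    by apply: tE => //; exact: lt_k.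
  rewrite !mxE summxE big1 => [|j jk].
    rewrite subr0 (_ : (l == o) = false) ?andbF ?mulr0 //.
    by apply/negbTE; rewrite eq_sym -val_eqE /= ltn_eqF.
  by rewrite mxE (tE x j l) ?mulr0 // (ltn_trans jk).
Qed.

End GramSchmidt.

(** * From charts to the manifold *)

Section Globalization.
Context {R : realType} {m n : nat} {M : topologicalType}.
Context {A : smooth_manifold R m M} {g : riemannian_metric A}.
Context {iota : M -> 'rV[R]_n} (iota_isom : isometric_immersion g iota).

Lemma chart_patch (a : atlas A) :
  isometric_patch (cimage a) (gmx g a) (iota \o param a).
Proof.
have [sF _ isomF] := iota_isom a.
split; [exact: cimage_open|exact: gmx_smooth|exact: gmx_sym|exact: gmx_pos|
  by []|].
move=> x Ux u v; have dF := smooth_on_differentiable sF Ux.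
exact: etrans (congr2 (fun y z => dotE y z) (deriveE _ dF) (deriveE _ dF))
  (isomF x Ux u v).
Qed.

Definition chart_frame (a : atlas A) : 'I_m -> 'rV[R]_m -> 'rV[R]_m :=
  projT1 (cid (orthonormal_frame_exists (@cimage_open _ _ _ _ a)
    (@gmx_smooth _ _ _ _ g a) (@gmx_sym _ _ _ _ g a) (@gmx_pos _ _ _ _ g a))).

Lemma chart_frame_orthonormal a :
  orthonormal_frame (gmx g a) (cimage a) (chart_frame a).
Proof. by rewrite /chart_frame; case: cid. Qed.

Definition chart_tension (a : atlas A) : 'rV[R]_m -> 'rV[R]_n :=
  tension_field (gmx g a) (chart_frame a) (iota \o param a).

Lemma overlap_open (a b : atlas A) : open (Defs.coord a @` (cdom a `&` cdom b)).
Proof.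
have -> : Defs.coord a @` (cdom a `&` cdom b) =
    cimage a `&` param a @^-1` cdom b.
  apply/seteqP; split=> [_ [p [ap bp] <-]|_ [[p ap <-] /=]].
    by split; [exists p|rewrite /= Defs.coordK].
  by rewrite Defs.coordK // => bp; exists p.
apply: (continuous_inP _ (@cimage_open _ _ _ _ a)).1 (@cdom_open _ _ _ _ b).
rewrite -continuous_open_subspace; first exact: param_continuous.
exact: cimage_open.
Qed.

Lemma chart_tension_overlap a b p : cdom a p -> cdom b p ->
  chart_tension a (Defs.coord a p) = chart_tension b (Defs.coord b p).
Proof.
move=> ap bp.
have -> : Defs.coord b p = (Defs.coord b \o param a) (Defs.coord a p).
  by rewrite /= Defs.coordK.
have Wp : (Defs.coord a @` (cdom a `&` cdom b)) (Defs.coord a p) by exists p.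
apply: (tension_field_reparam (chart_patch a) (chart_patch b)
  (chart_frame_orthonormal a) (chart_frame_orthonormal b)
  (psi := Defs.coord b \o param a) (@overlap_open a b) _ _ _ _ _ Wp).
- by move=> _ [q [aq _] <-]; exists q.
- by move=> _ [q [aq bq] <-]; exists q => //=; rewrite Defs.coordK.
- exact: transition_smooth.
- by move=> _ [q [aq bq] <-]; rewrite /= !Defs.coordK.
- exact: gmx_compat Wp.
Qed.

Lemma continuous_in_charts (q : M -> R) (f : atlas A -> 'rV[R]_m -> R) :
  (forall a x, cimage a x -> {for x, continuous (f a)}) ->
  (forall a p, cdom a p -> q p = f a (Defs.coord a p)) -> continuous q.
Proof.
move=> cf qE p; have [a ap] := cdom_cover A p.
have cc : {for p, continuous (Defs.coord a)}.
  have /(_ p) : {in cdom a, continuous (Defs.coord a)}.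
    rewrite -continuous_open_subspace; first exact: Defs.coord_continuous.
    exact: cdom_open.
  by apply; rewrite inE.
have cfc : {for p, continuous (fun p => f a (Defs.coord a p))}.
  by apply: continuous_comp => //; apply: cf; exists p.
rewrite /continuous_at (qE a p ap); apply: cvg_trans cfc; apply: near_eq_cvg.
have na : \forall r \near p, cdom a r.
  by apply: open_nbhs_nbhs; split => //; exact: cdom_open.
by near=> r; apply/esym/qE; near: r.
Unshelve. all: by end_near. Qed.

(** The functions f a on the charts are the coordinate expressions of one
    function q on M; its global maximum is a maximum within any chart around
    it. *)
Lemma compact_max_in_chart (q : M -> R) (f : atlas A -> 'rV[R]_m -> R) :
  [set: M] !=set0 -> compact [set: M] ->
  (forall a x, cimage a x -> {for x, continuous (f a)}) ->
  (forall a p, cdom a p -> q p = f a (Defs.coord a p)) ->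
  exists p a, [/\ cdom a p, forall r, q r <= q p &
    forall y, cimage a y -> f a y <= f a (Defs.coord a p)].
Proof.
move=> M0 cM cf qE; have cq := continuous_in_charts cf qE.
have [p _ pmax] := compact_EVT_max M0 cM (continuous_subspaceT cq).
have {}pmax r : q r <= q p by apply: pmax; rewrite inE.
have [a ap] := cdom_cover A p; exists p, a; split=> // _ [r ar <-].
by rewrite -(qE a r ar) -(qE a p ap).
Qed.

End Globalization.

Theorem theorem5p3 (R : realType) (m n : nat) (m_gt0 : (0 < m)%N)
    (M : topologicalType) (A : smooth_manifold R m M)
    (M_neq0 : [set: M] !=set0) (M_connected : connected [set: M])
    (g : riemannian_metric A) (iota : M -> 'rV[R]_n)
    (iota_isom : isometric_immersion g iota) :
  compact [set: M] -> ~ H_tensional g iota.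
Proof.
move=> cM harm.
have cont_sq a (f : 'rV[R]_m -> 'rV[R]_n) x : smooth_on (cimage a) f ->
    cimage a x -> {for x, continuous (fun y => dotE (f y) (f y))}.
  move=> sf Ux; apply: differentiable_continuous.
  by apply: smooth_on_differentiable Ux; apply: smooth_on_dotE => //;
    exact: cimage_open.
pose tau a := chart_tension (g := g) (iota := iota) a.
have sTau a : smooth_on (cimage a) (tau a).
  exact: (tension_field_smooth (chart_patch iota_isom a)
    (chart_frame_orthonormal a)).
pose chart p : atlas A := projT1 (cid (cdom_cover A p)).
have chartP p : cdom (chart p) p by rewrite /chart; case: cid.
pose Tau p := tau (chart p) (Defs.coord (chart p) p).
have TauE a p : cdom a p -> Tau p = tau a (Defs.coord a p).
  by move=> ap; exact: (chart_tension_overlap iota_isom).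
have Tau0 p : Tau p = 0.
  have [||p0 [a [ap0 Tmax tmax]]] := compact_max_in_chart
    (q := fun p => dotE (Tau p) (Tau p))
    (f := fun a x => dotE (tau a x) (tau a x)) M_neq0 cM.
  - by move=> a x; exact: cont_sq.
  - by move=> a r ar; rewrite (TauE a).
  have Ux0 : cimage a (Defs.coord a p0) by exists p0.
  have t0 : tau a (Defs.coord a p0) = 0.
    apply: (tension_eq0_at_max (chart_patch iota_isom a)
      (chart_frame_orthonormal a) Ux0) => //.
    exact: (harm a (cimage a) (chart_frame a) (@cimage_open _ _ _ _ a)
      (@subset_refl _ _) (chart_frame_orthonormal a)).
  apply: dotE_eq0; apply/eqP; rewrite eq_le dotE_ge0 andbT.
  by rewrite (le_trans (Tmax p)) // (TauE a p0 ap0) t0 dotE0l.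
have [||p [a [ap _ imax]]] := compact_max_in_chart
  (q := fun p => dotE (iota p) (iota p))
  (f := fun (a : atlas A) x => dotE (iota (param a x)) (iota (param a x)))
  M_neq0 cM.
- by move=> a x; apply: cont_sq; exact: patch_smoothF (chart_patch iota_isom a).
- by move=> a r ar; rewrite Defs.coordK.
have Ux : cimage a (Defs.coord a p) by exists p.
have /eqP := tension_neq0_at_max (chart_patch iota_isom a)
  (chart_frame_orthonormal a) m_gt0 Ux imax.
by apply; apply: etrans (esym (TauE a p ap)) (Tau0 p).
Qed.
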